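(* Let $(\alpha_0(n))_{n\ge1}$ and $(\alpha_1(n))_{n\ge1}$ be convergent real sequences such that, for all $n$, $$2\alpha_0(n)+\alpha_1(n)=1,\qquad \alpha_0(n)\ge 0,\qquad \alpha_0(n)+\alpha_1(n)\ge 0,$$ and let $l_0=\lim_{n\to\infty}\alpha_0(n)$. Let $U_n^{1}$ be the associated modified genuine Bernstein-Durrmeyer operator. If $f:[0,1]\to\mathbb{R}$ is twice differentiable with $f''\in C[0,1]$, then $$\lim_{n\to\infty} n\left(U_n^{1}(f;x)-f(x)\right)=(1-2x)(1-l_0)f'(x)+x(1-x)f''(x),$$ uniformly with respect to $x\in[0,1]$.
   Context: For integers $m\ge 0$ and $0\le k\le m$, let $p_{m,k}(x)=\binom{m}{k}x^k(1-x)^{m-k}$, $x\in[0,1]$. Given real sequences $\alpha_0(n),\alpha_1(n)$, put $\alpha(x,n)=\alpha_1(n)x+\alpha_0(n)$. The modified genuine Bernstein-Durrmeyer operator is $$U_n^{1}(f;x)=\alpha(x,n)(1-x)^{n-1}f(0)+\alpha(1-x,n)x^{n-1}f(1)+(n-1)\sum_{k=1}^{n-1}\left\{\alpha(x,n)p_{n-1,k}(x)+\alpha(1-x,n)p_{n-1,k-1}(x)\right\}\int_0^1 p_{n-2,k-1}(t)f(t)\,dt,$$ for $x\in[0,1]$, where the empty sum (case $n=1$) is $0$ and $0^0=1$. The condition $2\alpha_0(n)+\alpha_1(n)=1$ expresses that $U_n^1$ maps the constant function $1$ to itself. *)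

(* Defs.v *)
From Stdlib Require Import Reals.
From Coquelicot Require Import Coquelicot.
Open Scope R_scope.

Definition unit_interval (x : R) : Prop := 0 <= x <= 1.

(* [Binomial.C] is the real-valued binomial coefficient of the standard
   library (plain [C] is Coquelicot's type of complex numbers). It is the
   usual coefficient only for [k <= m], the only case used below. *)
Definition bernstein (m k : nat) (x : R) : R :=
  Binomial.C m k * x ^ k * (1 - x) ^ (m - k).

Definition alpha_lin (a0 a1 : nat -> R) (x : R) (n : nat) : R :=
  a1 n * x + a0 n.

(* Meaningful for [1 <= n]. For [n = 1] the sum ranges over the empty interval
   from 1 to 0, hence is 0; elsewhere the truncated subtractions are exact
   because [1 <= k <= n - 1]. Only the values of [f] on [0, 1] matter. *)
Definition genuine_BD (a0 a1 : nat -> R) (n : nat) (f : R -> R) (x : R) : R :=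
  alpha_lin a0 a1 x n * (1 - x) ^ (n - 1) * f 0
  + alpha_lin a0 a1 (1 - x) n * x ^ (n - 1) * f 1
  + (INR n - 1) *
    sum_n_m
      (fun k : nat =>
         (alpha_lin a0 a1 x n * bernstein (n - 1) k x
          + alpha_lin a0 a1 (1 - x) n * bernstein (n - 1) (k - 1) x)
         * RInt (fun t => bernstein (n - 2) (k - 1) t * f t) 0 1)
      1 (n - 1).

(* Main.v *)
Require Import Defs.
From Stdlib Require Import Reals Factorial Lra Lia.
From Coquelicot Require Import Coquelicot.
Open Scope R_scope.

(** The operator is a convex combination of two positive operators. Write
    [F_k g] for [(n - 1)] times the integral of [p_(n-2,k-1) g] when
    [0 < k < n], and [F_0 g = g 0], [F_n g = g 1]: this is the expectation of
    [g] under the Beta law with parameters [k] and [n - k], degenerating to a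
    point mass at both ends. Then

      [U_n g (x) = alpha(x) E[F_k g] + alpha(1-x) E[F_(k+1) g]]

    where [k] is binomial with parameters [n - 1] and [x]. The assumptions on
    the two sequences say exactly that the weights [alpha(x)] and
    [alpha(1-x)] are nonnegative on the unit interval and add up to 1. Hence
    [U_n] is positive, and [|g - h| <= P] on [0, 1] implies
    [|U_n g - U_n h| <= U_n P] ([genuine_BD_dist_le]).

    The moments of the Beta law are quotients of rising factorials, those of
    the binomial law are polynomials, so [U_n] is explicit on polynomials of
    degree at most 4 ([genuine_BD_quartic]). With [y = n], this gives
    - [y U_n(t - x) = (1 - a0) (1 - 2x)], exactly;
    - [y U_n((t - x)^2) = 2x(1 - x) + O(1/y)], uniformly in [x];
    - [y U_n((t - x)^4) = O(1/y)], uniformly in [x].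

    A quantitative Taylor formula ([taylor_remainder_le]) bounds the distance
    from [f] to its second-order Taylor polynomial at [x] by
    [eps (t - x)^2 + C (t - x)^4], where [C] depends on [eps] but not on [x]:
    the first term comes from the uniform continuity of [f''] and accounts for
    [t] near [x], the second one from the boundedness of [f''] and accounts
    for the other [t]. The first two moments applied to the Taylor polynomial
    produce the limit, up to [f' x (1 - 2x) (l0 - a0)] and [O(1/y)]; the second
    and fourth applied to the remainder show that it contributes at most
    [O(eps) + O(1/y)]. *)

(** * Means over the Bernstein basis *)

Definition quartic (c0 c1 c2 c3 c4 t : R) : R :=
  c0 + c1 * t + c2 * t ^ 2 + c3 * t ^ 3 + c4 * t ^ 4.

Definition bernstein_mean (m : nat) (x : R) (G : nat -> R) : R :=
  sum_n_m (fun k => bernstein m k x * G k) 0 m.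

Lemma bernstein_m_0 (m : nat) (x : R) : bernstein m 0 x = (1 - x) ^ m.
Proof.
  unfold bernstein, Binomial.C. rewrite Nat.sub_0_r. change (INR (fact 0)) with 1.
  rewrite pow_O. field. apply INR_fact_neq_0.
Qed.

Lemma bernstein_m_m (m : nat) (x : R) : bernstein m m x = x ^ m.
Proof.
  unfold bernstein, Binomial.C. rewrite Nat.sub_diag. change (INR (fact 0)) with 1.
  rewrite pow_O. field. apply INR_fact_neq_0.
Qed.

Lemma bernstein_S_S (m k : nat) (x : R) : (k < m)%nat ->
  bernstein (S m) (S k) x = (1 - x) * bernstein m (S k) x + x * bernstein m k x.
Proof.
  intros Hk. unfold bernstein. rewrite <- (Binomial.pascal m k Hk).
  replace (S m - S k)%nat with (S (m - S k)) by lia.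
  replace (m - k)%nat with (S (m - S k)) by lia.
  simpl. ring.
Qed.

Lemma bernstein_ge0 (m k : nat) (x : R) : 0 <= x <= 1 -> 0 <= bernstein m k x.
Proof.
  intros Hx. unfold bernstein, Binomial.C.
  repeat apply Rmult_le_pos; try (apply pow_le; lra); try apply pos_INR.
  apply Rlt_le, Rinv_0_lt_compat, Rmult_lt_0_compat; apply INR_fact_lt_0.
Qed.

(** Conditioning on the last of [m + 1] Bernoulli trials. All binomial moments
    follow from this recursion by induction on [m], with no sums to evaluate. *)
Lemma bernstein_mean_S (m : nat) (x : R) (G : nat -> R) :
  bernstein_mean (S m) x G
  = (1 - x) * bernstein_mean m x G + x * bernstein_mean m x (fun k => G (S k)).
Proof.
  (* Pascal's rule fails at [k = m], where [Binomial.C m (S m)] is not 0, so it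
     is applied to partial sums, and the last term is split off. *)
  assert (Hpart : forall K, (K <= m)%nat ->
    sum_n_m (fun k => bernstein (S m) k x * G k) 0 K
    = (1 - x) * sum_n_m (fun k => bernstein m k x * G k) 0 K
      + x * (sum_n_m (fun k => bernstein m k x * G (S k)) 0 K
             - bernstein m K x * G (S K))).
  { induction K as [|K IH]; intros HK.
    - rewrite !sum_n_n, !bernstein_m_0. simpl. ring.
    - rewrite !sum_n_Sm by lia. rewrite IH by lia.
      rewrite bernstein_S_S by lia. unfold plus; simpl. ring. }
  unfold bernstein_mean.
  rewrite sum_n_Sm by lia. rewrite Hpart by lia.
  rewrite !bernstein_m_m. unfold plus; simpl. ring.
Qed.

(** Carrying all the coefficients at once makes the induction closed: shifting
    the argument of a quartic by 1 gives a quartic. The coefficients 1, 3 and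
    1, 6, 7 are Stirling numbers of the second kind. *)
Lemma bernstein_mean_quartic (m : nat) (x c0 c1 c2 c3 c4 : R) :
  bernstein_mean m x (fun k => quartic c0 c1 c2 c3 c4 (INR k))
  = let y := INR m in
    let y2 := y * (y - 1) in
    let y3 := y2 * (y - 2) in
    let y4 := y3 * (y - 3) in
    c0 + c1 * (y * x)
    + c2 * (y2 * x ^ 2 + y * x)
    + c3 * (y3 * x ^ 3 + 3 * y2 * x ^ 2 + y * x)
    + c4 * (y4 * x ^ 4 + 6 * y3 * x ^ 3 + 7 * y2 * x ^ 2 + y * x).
Proof.
  revert c0 c1 c2 c3 c4; induction m as [|m IH]; intros; cbv zeta.
  - unfold bernstein_mean. rewrite sum_n_n, bernstein_m_0.
    unfold quartic; simpl. ring.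
  - rewrite bernstein_mean_S, IH.
    replace (bernstein_mean m x _) with
      (bernstein_mean m x (fun k =>
         quartic (c0 + c1 + c2 + c3 + c4) (c1 + 2 * c2 + 3 * c3 + 4 * c4)
           (c2 + 3 * c3 + 6 * c4) (c3 + 4 * c4) c4 (INR k))).
    + rewrite IH, S_INR. cbv zeta. ring.
    + apply sum_n_m_ext. intros k. f_equal. rewrite S_INR.
      unfold quartic. ring.
Qed.

Lemma bernstein_mean_ext (m : nat) (x : R) (G H : nat -> R) :
  (forall k, (k <= m)%nat -> G k = H k) ->
  bernstein_mean m x G = bernstein_mean m x H.
Proof.
  intros E. apply sum_n_m_ext_loc. intros k Hk. now rewrite E by lia.
Qed.

Lemma sum_n_m_lin (a b : R) (u v : nat -> R) (n m : nat) :
  sum_n_m (fun k => a * u k + b * v k) n m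
  = a * sum_n_m u n m + b * sum_n_m v n m.
Proof.
  etransitivity;
    [apply (sum_n_m_plus (G := R_AbelianMonoid) (fun k => a * u k) (fun k => b * v k))|].
  apply f_equal2; apply (sum_n_m_mult_l (K := R_Ring)).
Qed.

Lemma sum_n_m_le_loc (a b : nat -> R) (n m : nat) :
  (forall k, (n <= k <= m)%nat -> a k <= b k) ->
  sum_n_m a n m <= sum_n_m b n m.
Proof.
  intros H. destruct (Nat.le_gt_cases n m) as [Hnm|Hnm].
  - induction Hnm as [|m Hnm IH].
    + rewrite !sum_n_n. apply H. lia.
    + rewrite !sum_n_Sm by lia. apply Rplus_le_compat; [apply IH; intros|]; apply H; lia.
  - rewrite !sum_n_m_zero by lia. apply Rle_refl.
Qed.

Lemma bernstein_mean_dist_le (m : nat) (x : R) (G H P : nat -> R) :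
  0 <= x <= 1 ->
  (forall k, (k <= m)%nat -> Rabs (G k - H k) <= P k) ->
  Rabs (bernstein_mean m x G - bernstein_mean m x H) <= bernstein_mean m x P.
Proof.
  intros Hx HP. unfold bernstein_mean.
  replace (sum_n_m (fun k => bernstein m k x * G k) 0 m
           - sum_n_m (fun k => bernstein m k x * H k) 0 m)
    with (sum_n_m (fun k => bernstein m k x * (G k - H k)) 0 m).
  - eapply Rle_trans; [apply (norm_sum_n_m (K := R_AbsRing) (V := R_NormedModule))|].
    apply sum_n_m_le_loc. intros k Hk.
    change (Rabs (bernstein m k x * (G k - H k)) <= bernstein m k x * P k).
    rewrite Rabs_mult, Rabs_pos_eq by now apply bernstein_ge0.
    apply Rmult_le_compat_l; [now apply bernstein_ge0 | apply HP; lia].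
  - rewrite (sum_n_m_ext _ (fun k => 1 * (bernstein m k x * G k)
        + -1 * (bernstein m k x * H k))) by (intros k; simpl; ring).
    rewrite sum_n_m_lin.
    match goal with |- ?a = ?b => change (@eq R a b) end. ring.
Qed.

(** * The operator as a mean of Beta expectations *)

(** Euler's Beta integral. The induction transfers a factor from one base to
    the other, by integrating the derivative of [t^(a+1) (1-t)^(b+1)], a
    function that vanishes at both ends. *)
Lemma is_RInt_beta (b a : nat) :
  is_RInt (fun t => t ^ a * (1 - t) ^ b) 0 1
    (INR (fact a) * INR (fact b) / INR (fact (S (a + b)))).
Proof.
  revert a; induction b as [|b IH]; intros a.
  - rewrite Nat.add_0_r.
    replace (INR (fact a) * INR (fact 0) / INR (fact (S a)))
      with (minus (1 ^ S a / INR (S a)) (0 ^ S a / INR (S a))).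
    + apply is_RInt_ext with (fun t => t ^ a); [intros t _; simpl; ring|].
      apply (is_RInt_derive (V := R_CompleteNormedModule) (fun t => t ^ S a / INR (S a))).
      * intros t _. auto_derive; [easy|].
        (* Differentiation has reduced [INR (S a)] to its defining match. *)
        change (match a with O => 1 | S _ => INR a + 1 end) with (INR (S a)).
        field. apply not_0_INR; lia.
      * intros t _. apply (ex_derive_continuous (fun t => t ^ a)). auto_derive; easy.
    + rewrite (fact_simpl a), mult_INR. unfold minus, plus, opp; simpl plus.
      rewrite pow1, pow_i by lia. change (INR (fact 0)) with 1.
      change (1 / INR (S a) + - (0 / INR (S a)) = INR (fact a) * 1 / (INR (S a) * INR (fact a))).
      field. split; [apply INR_fact_neq_0 | apply not_0_INR; lia].
  - assert (HD : is_RInt (fun t => INR (S a) * (t ^ a * (1 - t) ^ S b)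
                      - INR (S b) * (t ^ S a * (1 - t) ^ b)) 0 1
                  (minus (1 ^ S a * (1 - 1) ^ S b) (0 ^ S a * (1 - 0) ^ S b))).
    { apply (is_RInt_derive (V := R_CompleteNormedModule)
               (fun t => t ^ S a * (1 - t) ^ S b)).
      - intros t _. auto_derive; [easy|]. cbn [Nat.pred].
        change (match a with O => 1 | S _ => INR a + 1 end) with (INR (S a)).
        change (match b with O => 1 | S _ => INR b + 1 end) with (INR (S b)).
        cbn [pow]. change (1 + - t) with (1 - t). ring.
      - intros t _.
        apply (ex_derive_continuous (fun t => INR (S a) * (t ^ a * (1 - t) ^ S b)
                      - INR (S b) * (t ^ S a * (1 - t) ^ b))). auto_derive; easy. }
    replace (minus _ _) with 0 in HD by (unfold minus, plus, opp; simpl; ring).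
    pose proof (is_RInt_scal _ _ _ (/ INR (S a)) _ (is_RInt_plus _ _ _ _ _ _ HD
      (is_RInt_scal _ _ _ (INR (S b)) _ (IH (S a))))) as H.
    assert (Ha : INR (S a) <> 0) by (apply not_0_INR; lia).
    replace (INR (fact a) * INR (fact (S b)) / INR (fact (S (a + S b)))) with
      (/ INR (S a) * (0 +
         (INR (S b) * (INR (fact (S a)) * INR (fact b) / INR (fact (S (S a + b))))))).
    + apply is_RInt_ext with (2 := H). intros t _.
      unfold scal, plus; cbn -[INR pow]; unfold mult; cbn -[INR pow].
      field. exact Ha.
    + replace (S (a + S b)) with (S (S a + b)) by lia.
      rewrite (fact_simpl a), (fact_simpl b), !mult_INR.
      field. split; [apply INR_fact_neq_0 | exact Ha].
Qed.

Lemma is_RInt_bernstein_pow (p j r : nat) : (j <= p)%nat ->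
  is_RInt (fun t => bernstein p j t * t ^ r) 0 1
    (INR (fact p) * INR (fact (j + r)) / (INR (fact j) * INR (fact (S (p + r))))).
Proof.
  intros Hj.
  pose proof (is_RInt_scal _ _ _ (Binomial.C p j) _ (is_RInt_beta (p - j) (j + r))) as H.
  replace (S (j + r + (p - j))) with (S (p + r)) in H by lia.
  match type of H with is_RInt _ _ _ ?l => replace (_ / _) with l end.
  - apply is_RInt_ext with (2 := H). intros t _.
    unfold scal; simpl; unfold mult; simpl. unfold bernstein. rewrite pow_add. ring.
  - unfold scal; cbn -[fact]; unfold mult; cbn -[fact]. unfold Binomial.C.
    field. repeat split; apply INR_fact_neq_0.
Qed.

(** The functional [F_k] of the introduction. Giving the end points their own
    cases turns the separate terms of the operator at [f 0] and [f 1] into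
    ordinary terms of a binomial mean. *)
Definition node (n k : nat) (g : R -> R) : R :=
  if Nat.eqb k 0 then g 0
  else if Nat.eqb k n then g 1
  else (INR n - 1) * RInt (fun t => bernstein (n - 2) (k - 1) t * g t) 0 1.

Lemma genuine_BD_node (a0 a1 : nat -> R) (n : nat) (g : R -> R) (x : R) :
  (2 <= n)%nat ->
  genuine_BD a0 a1 n g x
  = alpha_lin a0 a1 x n * bernstein_mean (n - 1) x (fun k => node n k g)
    + alpha_lin a0 a1 (1 - x) n
      * bernstein_mean (n - 1) x (fun k => node n (S k) g).
Proof.
  intros Hn. destruct n as [|[|p]]; try lia.
  set (n := S (S p)). unfold genuine_BD, bernstein_mean.
  replace (n - 1)%nat with (S p) by (unfold n; lia).
  set (I := fun k => (INR n - 1) * RInt (fun t => bernstein (n - 2) (k - 1) t * g t) 0 1).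
  assert (HI : forall k, (1 <= k <= S p)%nat -> node n k g = I k).
  { intros k Hk. unfold node, I.
    destruct (Nat.eqb_spec k 0); [lia|]. destruct (Nat.eqb_spec k n); [unfold n in *; lia|].
    reflexivity. }
  (* One mean has its extra term at [k = 0], the other at [k = n - 1]; after a
     shift of the latter both leave a sum over [1 <= k <= n - 1]. *)
  rewrite (sum_Sn_m (fun k => bernstein (S p) k x * node n k g)) by lia.
  rewrite (sum_n_Sm (fun k => bernstein (S p) k x * node n (S k) g)) by lia.
  rewrite bernstein_m_0, bernstein_m_m.
  replace (node n 0 g) with (g 0) by reflexivity.
  replace (node n (S (S p)) g) with (g 1)
    by (unfold node, n; rewrite Nat.eqb_refl; reflexivity).
  rewrite (sum_n_m_ext_loc (fun k => bernstein (S p) k x * node n k g)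
             (fun k => bernstein (S p) k x * I k))
    by (intros k Hk; rewrite HI by lia; reflexivity).
  rewrite (sum_n_m_ext_loc (fun k => bernstein (S p) k x * node n (S k) g)
     (fun k => bernstein (S p) (S k - 1) x * I (S k)))
    by (intros k Hk; rewrite HI by lia; do 2 f_equal; lia).
  rewrite (sum_n_m_S (fun k => bernstein (S p) (k - 1) x * I k)).
  match goal with |- _ + (INR n - 1) * ?s = _ =>
    replace ((INR n - 1) * s) with
      (alpha_lin a0 a1 x n * sum_n_m (fun k => bernstein (S p) k x * I k) 1 (S p)
       + alpha_lin a0 a1 (1 - x) n
         * sum_n_m (fun k => bernstein (S p) (k - 1) x * I k) 1 (S p))
  end.
  - unfold plus; simpl. ring.
  - rewrite <- sum_n_m_lin.
    rewrite <- (sum_n_m_mult_l (K := R_Ring) (INR n - 1)).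
    apply sum_n_m_ext. intros k. unfold I, mult; simpl. ring.
Qed.

(** * Functions on the unit interval *)

(** The hypotheses on [f] only concern the unit interval, while integrability
    and the mean value theorem are available for functions continuous on the
    line. Composing with the retraction onto the unit interval reconciles
    both. *)
Definition clamp (t : R) : R := Rmax 0 (Rmin 1 t).

Lemma clamp_in (t : R) : unit_interval (clamp t).
Proof.
  unfold clamp, unit_interval, Rmax, Rmin.
  destruct (Rle_dec 1 t); destruct (Rle_dec 0 _); lra.
Qed.

Lemma clamp_id (t : R) : unit_interval t -> clamp t = t.
Proof.
  unfold clamp, unit_interval, Rmax, Rmin; intros.
  destruct (Rle_dec 1 t); destruct (Rle_dec 0 _); lra.
Qed.

Lemma clamp_dist (s t : R) : Rabs (clamp s - clamp t) <= Rabs (s - t).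
Proof.
  unfold clamp, Rmax, Rmin.
  repeat destruct (Rle_dec _ _); unfold Rabs; repeat destruct (Rcase_abs _); lra.
Qed.

Lemma continuity_clamp (g : R -> R) :
  (forall x, unit_interval x -> continue_in g unit_interval x) ->
  continuity (fun t => g (clamp t)).
Proof.
  intros Hg t eps Heps.
  destruct (Hg _ (clamp_in t) eps Heps) as [d [Hd H]].
  exists d; split; [exact Hd|]. intros s [_ Hs].
  destruct (Req_dec (clamp s) (clamp t)) as [E|E].
  - simpl. unfold R_dist. rewrite E, Rminus_diag, Rabs_R0. exact Heps.
  - apply (H (clamp s)). split.
    + split; [apply clamp_in | auto].
    + eapply Rle_lt_trans; [apply clamp_dist | exact Hs].
Qed.

Lemma ex_RInt_bernstein_mult (p j : nat) (g : R -> R) :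
  (forall x, unit_interval x -> continue_in g unit_interval x) ->
  ex_RInt (fun t => bernstein p j t * g t) 0 1.
Proof.
  intros Hg. apply ex_RInt_ext with (fun t => bernstein p j t * g (clamp t)).
  - intros t Ht. rewrite Rmin_left, Rmax_right in Ht by lra.
    rewrite clamp_id; [reflexivity | unfold unit_interval; lra].
  - apply (ex_RInt_continuous (V := R_CompleteNormedModule)). intros t _.
    apply (continuous_mult (K := R_AbsRing) (bernstein p j) (fun t => g (clamp t))).
    + apply (ex_derive_continuous (bernstein p j)). unfold bernstein. auto_derive; easy.
    + apply continuity_pt_filterlim, continuity_clamp, Hg.
Qed.

(** * Positivity and moments of the operator *)

Lemma node_dist_le (n k : nat) (g h P : R -> R) :
  (1 <= n)%nat ->
  (forall x, unit_interval x -> continue_in g unit_interval x) ->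
  (forall x, unit_interval x -> continue_in h unit_interval x) ->
  (forall x, unit_interval x -> continue_in P unit_interval x) ->
  (forall t, unit_interval t -> Rabs (g t - h t) <= P t) ->
  Rabs (node n k g - node n k h) <= node n k P.
Proof.
  intros Hn Hg Hh HP H. unfold node.
  destruct (Nat.eqb k 0); [apply H; unfold unit_interval; lra|].
  destruct (Nat.eqb k n); [apply H; unfold unit_interval; lra|].
  apply (ex_RInt_bernstein_mult (n - 2) (k - 1)) in Hg, Hh, HP.
  pose proof (le_INR _ _ Hn) as Hn'; simpl in Hn'.
  set (b := bernstein (n - 2) (k - 1)) in *.
  assert (Hb : forall t, 0 < t < 1 -> 0 <= b t) by (intros; apply bernstein_ge0; lra).
  rewrite <- Rmult_minus_distr_l, Rabs_mult, Rabs_pos_eq by lra.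
  apply Rmult_le_compat_l; [lra|].
  assert (E : RInt (fun t => b t * g t) 0 1 - RInt (fun t => b t * h t) 0 1
              = RInt (fun t => b t * g t - b t * h t) 0 1)
    by (symmetry; now apply (RInt_minus (V := R_CompleteNormedModule))).
  rewrite E.
  assert (Hex : ex_RInt (fun t => b t * g t - b t * h t) 0 1)
    by now apply (ex_RInt_minus (V := R_NormedModule) (fun t => b t * g t) (fun t => b t * h t)).
  assert (Hpt : forall t, 0 < t < 1 -> Rabs (b t * g t - b t * h t) <= b t * P t).
  { intros t Ht. rewrite <- Rmult_minus_distr_l, Rabs_mult, Rabs_pos_eq by now apply Hb.
    apply Rmult_le_compat_l; [now apply Hb|]. apply H. unfold unit_interval; lra. }
  eapply Rle_trans; [apply abs_RInt_le; [lra | exact Hex]|].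
  apply RInt_le; [lra | | exact HP | exact Hpt].
  now apply (ex_RInt_norm (fun t => b t * g t - b t * h t)).
Qed.

(** The moments of the Beta law; at [k = 0] and [k = n] the same formula gives
    those of the two point masses. *)
Lemma node_quartic (n k : nat) (c0 c1 c2 c3 c4 : R) :
  (2 <= n)%nat -> (k <= n)%nat ->
  node n k (quartic c0 c1 c2 c3 c4)
  = let y := INR n in
    let i := INR k in
    c0 + c1 * (i / y)
    + c2 * (i * (i + 1) / (y * (y + 1)))
    + c3 * (i * (i + 1) * (i + 2) / (y * (y + 1) * (y + 2)))
    + c4 * (i * (i + 1) * (i + 2) * (i + 3) / (y * (y + 1) * (y + 2) * (y + 3))).
Proof.
  intros Hn Hk; cbv zeta.
  pose proof (lt_0_INR n ltac:(lia)) as Hy.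
  unfold node.
  destruct (Nat.eqb_spec k 0) as [->|Hk0].
  { unfold quartic. change (INR 0) with 0. field. lra. }
  destruct (Nat.eqb_spec k n) as [->|Hkn].
  { unfold quartic. field. lra. }
  destruct n as [|[|p]]; [lia|lia|]. destruct k as [|j]; [lia|].
  replace (S (S p) - 2)%nat with p by lia. replace (S j - 1)%nat with j by lia.
  assert (Hj : (j <= p)%nat) by lia.
  pose proof (fun r => is_RInt_bernstein_pow p j r Hj) as M.
  set (v := fun r => (INR (fact p) * INR (fact (j + r))
                      / (INR (fact j) * INR (fact (S (p + r)))))) in M.
  assert (HI : is_RInt (fun t => bernstein p j t * quartic c0 c1 c2 c3 c4 t) 0 1
     (c0 * v 0%nat + c1 * v 1%nat + c2 * v 2%nat + c3 * v 3%nat + c4 * v 4%nat)).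
  { apply is_RInt_ext with (fun t =>
      c0 * (bernstein p j t * t ^ 0) + c1 * (bernstein p j t * t ^ 1)
      + c2 * (bernstein p j t * t ^ 2) + c3 * (bernstein p j t * t ^ 3)
      + c4 * (bernstein p j t * t ^ 4)).
    { intros t _. unfold quartic. simpl. ring. }
    do 4 (apply (is_RInt_plus (V := R_NormedModule) (fun t => _) (fun t => _));
          [|apply (is_RInt_scal (V := R_NormedModule)), M]).
    apply (is_RInt_scal (V := R_NormedModule)), M. }
  rewrite (is_RInt_unique _ _ _ _ HI).
  assert (Hq : forall r, INR (S p) * v r
     = INR (fact (j + r)) / INR (fact j) * (INR (fact (S p)) / INR (fact (S p + r)))).
  { intros r. unfold v. rewrite (fact_simpl p), mult_INR.
    rewrite Nat.add_succ_l. field. split; apply INR_fact_neq_0. }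
  replace (INR (S (S p)) - 1) with (INR (S p)) by (rewrite !S_INR; ring).
  clearbody v.
  replace (INR (S p) * _) with
    (c0 * (INR (S p) * v 0%nat) + c1 * (INR (S p) * v 1%nat)
     + c2 * (INR (S p) * v 2%nat) + c3 * (INR (S p) * v 3%nat)
     + c4 * (INR (S p) * v 4%nat)) by ring.
  rewrite !Hq, !Nat.add_succ_r, !Nat.add_0_r.
  rewrite !(fact_simpl (S _)), !(fact_simpl j), !mult_INR, !S_INR.
  pose proof (INR_fact_neq_0 j) as Fj. pose proof (INR_fact_neq_0 (S p)) as Fp.
  set (u := INR (fact j)) in *. set (w := INR (fact (S p))) in *.
  pose proof (pos_INR p). set (z := INR p) in *. set (i := INR j).
  clearbody u w z i. clear - Fj Fp H.
  repeat apply f_equal2; try reflexivity;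
    (field; repeat split; try assumption; lra).
Qed.

(** Here [m1], ..., [m4] are the falling-factorial moments of the binomial law,
    and the integer coefficients convert them to moments of the rising
    factorials of [k] (Lah numbers) and of [k + 1]. *)
Lemma genuine_BD_quartic (a0 a1 : nat -> R) (n : nat) (c0 c1 c2 c3 c4 x : R) :
  (2 <= n)%nat ->
  genuine_BD a0 a1 n (quartic c0 c1 c2 c3 c4) x
  = let y := INR n in
    let m1 := (y - 1) * x in
    let m2 := (y - 1) * (y - 2) * x ^ 2 in
    let m3 := (y - 1) * (y - 2) * (y - 3) * x ^ 3 in
    let m4 := (y - 1) * (y - 2) * (y - 3) * (y - 4) * x ^ 4 in
    let moment := fun e1 e2 e3 e4 =>
      c0 + c1 * (e1 / y) + c2 * (e2 / (y * (y + 1)))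
      + c3 * (e3 / (y * (y + 1) * (y + 2)))
      + c4 * (e4 / (y * (y + 1) * (y + 2) * (y + 3))) in
    alpha_lin a0 a1 x n
      * moment m1 (m2 + 2 * m1) (m3 + 6 * m2 + 6 * m1)
          (m4 + 12 * m3 + 36 * m2 + 24 * m1)
    + alpha_lin a0 a1 (1 - x) n
      * moment (m1 + 1) (m2 + 4 * m1 + 2) (m3 + 9 * m2 + 18 * m1 + 6)
          (m4 + 16 * m3 + 72 * m2 + 96 * m1 + 24).
Proof.
  intros Hn; cbv zeta. rewrite genuine_BD_node by exact Hn.
  pose proof (lt_0_INR n ltac:(lia)) as Hy.
  set (y := INR n) in *.
  set (d1 := c1 / y). set (d2 := c2 / (y * (y + 1))).
  set (d3 := c3 / (y * (y + 1) * (y + 2))).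
  set (d4 := c4 / (y * (y + 1) * (y + 2) * (y + 3))).
  assert (E1 : forall e, c1 * (e / y) = d1 * e) by (intros; unfold d1; field; lra).
  assert (E2 : forall e, c2 * (e / (y * (y + 1))) = d2 * e)
    by (intros; unfold d2; field; lra).
  assert (E3 : forall e, c3 * (e / (y * (y + 1) * (y + 2))) = d3 * e)
    by (intros; unfold d3; field; lra).
  assert (E4 : forall e, c4 * (e / (y * (y + 1) * (y + 2) * (y + 3))) = d4 * e)
    by (intros; unfold d4; field; lra).
  (* Rising factorials in [k] are expanded in powers of [k]. *)
  assert (HN : forall k, (k <= n)%nat -> node n k (quartic c0 c1 c2 c3 c4)
    = quartic c0 (d1 + d2 + 2 * d3 + 6 * d4) (d2 + 3 * d3 + 11 * d4) (d3 + 6 * d4) d4 (INR k)).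
  { intros k Hk. rewrite node_quartic by lia. cbv zeta. fold y.
    rewrite E1, E2, E3, E4. unfold quartic. ring. }
  rewrite (bernstein_mean_ext _ _ (fun k => node n k _) (fun k => quartic c0
    (d1 + d2 + 2 * d3 + 6 * d4) (d2 + 3 * d3 + 11 * d4) (d3 + 6 * d4) d4 (INR k)))
    by (intros k Hk; apply HN; lia).
  rewrite (bernstein_mean_ext _ _ (fun k => node n (S k) _) (fun k => quartic
    (c0 + d1 + 2 * d2 + 6 * d3 + 24 * d4)
    (d1 + 3 * d2 + 11 * d3 + 50 * d4) (d2 + 6 * d3 + 35 * d4) (d3 + 10 * d4) d4 (INR k)))
    by (intros k Hk; rewrite HN, S_INR by lia; unfold quartic; ring).
  rewrite !bernstein_mean_quartic, !E1, !E2, !E3, !E4. cbv zeta.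
  rewrite minus_INR by lia. change (INR 1) with 1. fold y.
  clearbody d1 d2 d3 d4 y. ring.
Qed.

(** * Taylor approximation with a uniform remainder *)

Lemma bounded_on_unit_interval (g : R -> R) :
  (forall x, unit_interval x -> continue_in g unit_interval x) ->
  exists M, 0 <= M /\ forall x, unit_interval x -> Rabs (g x) <= M.
Proof.
  intros Hg.
  destruct (continuity_ab_maj (fun t => Rabs (g (clamp t))) 0 1) as [m [Hm _]]; [lra| |].
  - intros c _. apply (continuity_pt_comp (fun t => g (clamp t)) Rabs).
    + apply continuity_clamp, Hg.
    + apply Rcontinuity_abs.
  - exists (Rabs (g (clamp m))). split; [apply Rabs_pos|].
    intros x Hx. rewrite <- (clamp_id x Hx) at 1. apply Hm, Hx.
Qed.

(** Uniform continuity in a form that a positive operator can integrate: beyond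
    the distance [d] given by Heine's theorem, the oscillation, at most [2 M],
    is absorbed in a multiple of [((s - x) / d)^2]. *)
Lemma quadratic_modulus (g : R -> R) :
  (forall x, unit_interval x -> continue_in g unit_interval x) ->
  forall eps, 0 < eps -> exists C, 0 <= C /\
  forall x s, unit_interval x -> unit_interval s ->
    Rabs (g s - g x) <= eps + C * (s - x) ^ 2.
Proof.
  intros Hg eps Heps.
  destruct (bounded_on_unit_interval g Hg) as [M [HM HB]].
  destruct (Heine (fun t => g (clamp t)) (fun t => 0 <= t <= 1) (compact_P3 0 1)
              (fun t _ => continuity_clamp g Hg t) (mkposreal eps Heps)) as [d Hd].
  pose proof (cond_pos d) as Hd0.
  exists (2 * M / d ^ 2). split.
  - apply Rmult_le_pos; [lra|]. apply Rlt_le, Rinv_0_lt_compat, pow_lt, Hd0.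
  - intros x s Hx Hs. destruct (Rlt_le_dec (Rabs (s - x)) d) as [Hlt|Hge].
    + pose proof (Hd s x Hs Hx Hlt) as H. rewrite !clamp_id in H by assumption.
      simpl in H.
      assert (0 <= 2 * M / d ^ 2 * (s - x) ^ 2); [|lra].
      apply Rmult_le_pos; [|apply pow2_ge_0].
      apply Rmult_le_pos; [lra|]. apply Rlt_le, Rinv_0_lt_compat, pow_lt, Hd0.
    + assert (Rabs (g s - g x) <= 2 * M).
      { eapply Rle_trans; [apply Rabs_triang|]. rewrite Rabs_Ropp.
        pose proof (HB s Hs). pose proof (HB x Hx). lra. }
      assert (2 * M <= 2 * M / d ^ 2 * (s - x) ^ 2); [|lra].
      assert (d ^ 2 <= (s - x) ^ 2).
      { rewrite <- (pow2_abs (s - x)). apply pow_incr. lra. }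
      assert (0 < d ^ 2) by (apply pow_lt, Hd0).
      replace (2 * M) with (2 * M / d ^ 2 * d ^ 2) at 1 by (field; lra).
      apply Rmult_le_compat_l; [|assumption].
      apply Rmult_le_pos; [lra|]. apply Rlt_le, Rinv_0_lt_compat; lra.
Qed.

Lemma derivable_pt_lim_clamp (f f' : R -> R) (c : R) :
  D_in f f' unit_interval c -> 0 < c < 1 ->
  derivable_pt_lim (fun t => f (clamp t)) c (f' c).
Proof.
  intros Hf Hc eps Heps.
  destruct (Hf eps Heps) as [d [Hd H]].
  assert (Hm : 0 < Rmin d (Rmin c (1 - c))) by (repeat apply Rmin_pos; lra).
  exists (mkposreal _ Hm). intros h Hh0 Hh. simpl in Hh.
  pose proof (Rmin_l d (Rmin c (1 - c))). pose proof (Rmin_r d (Rmin c (1 - c))).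
  pose proof (Rmin_l c (1 - c)). pose proof (Rmin_r c (1 - c)).
  pose proof (Rle_abs h). pose proof (Rle_abs (- h)) as Hn. rewrite Rabs_Ropp in Hn.
  rewrite !clamp_id by (unfold unit_interval; lra).
  replace h with (c + h - c) at 2 by ring.
  apply (H (c + h)). split.
  - split; [unfold unit_interval; lra | lra].
  - simpl. unfold R_dist. replace (c + h - c) with h by ring. lra.
Qed.

(** The function is differentiable only relative to the interval; subtracting a
    globally differentiable [q] is built in, as the rules of differentiation
    are more convenient on that side. *)
Lemma MVT_unit_interval (f f' q q' : R -> R) (x t : R) :
  (forall x, unit_interval x -> D_in f f' unit_interval x) ->
  (forall x, is_derive q x (q' x)) ->
  unit_interval x -> unit_interval t ->
  exists c, Rmin x t <= c <= Rmax x t /\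
    (f t - q t) - (f x - q x) = (f' c - q' c) * (t - x).
Proof.
  intros Hf Hq Hx Ht.
  assert (Hlo : 0 <= Rmin x t) by (apply Rmin_glb; [apply Hx | apply Ht]).
  assert (Hhi : Rmax x t <= 1) by (apply Rmax_lub; [apply Hx | apply Ht]).
  destruct (MVT_gen (fun s => f (clamp s) - q s) x t (fun s => f' s - q' s)) as [c [Hc E]].
  - intros c Hc. apply (is_derive_minus (fun s => f (clamp s)) q); [|apply Hq].
    apply is_derive_Reals, derivable_pt_lim_clamp; [apply Hf; unfold unit_interval|]; lra.
  - intros c Hc. apply (continuity_pt_minus (fun s => f (clamp s)) q).
    + apply continuity_clamp. intros s Hs. eapply cont_deriv, Hf, Hs.
    + apply continuity_pt_filterlim, (ex_derive_continuous q). now exists (q' c).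
  - exists c. split; [exact Hc|]. now rewrite !clamp_id in E by assumption.
Qed.

Lemma Rabs_between (x t c : R) :
  Rmin x t <= c <= Rmax x t -> Rabs (c - x) <= Rabs (t - x).
Proof.
  unfold Rmin, Rmax. destruct (Rle_dec x t); intros;
    unfold Rabs; repeat destruct (Rcase_abs _); lra.
Qed.

Lemma unit_interval_between (x t c : R) :
  unit_interval x -> unit_interval t -> Rmin x t <= c <= Rmax x t -> unit_interval c.
Proof.
  unfold unit_interval, Rmin, Rmax. destruct (Rle_dec x t); lra.
Qed.

(** Two mean value steps: the remainder at [t] is
    [(f'' b - f'' x) (c - x) (t - x)] for some [c] between [x] and [t] and [b]
    between [x] and [c], and [quadratic_modulus] bounds the first factor. *)
Lemma taylor_remainder_le (f f' f'' : R -> R) :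
  (forall x, unit_interval x -> D_in f f' unit_interval x) ->
  (forall x, unit_interval x -> D_in f' f'' unit_interval x) ->
  (forall x, unit_interval x -> continue_in f'' unit_interval x) ->
  forall eps, 0 < eps -> exists C, 0 <= C /\
  forall x t, unit_interval x -> unit_interval t ->
    Rabs (f t - (f x + f' x * (t - x) + f'' x / 2 * (t - x) ^ 2))
    <= eps * (t - x) ^ 2 + C * (t - x) ^ 4.
Proof.
  intros Hf Hf' Hc eps Heps.
  destruct (quadratic_modulus f'' Hc eps Heps) as [C [HC Hmod]].
  exists C; split; [exact HC|]. intros x t Hx Ht.
  destruct (MVT_unit_interval f f' (fun s => f x + f' x * (s - x) + f'' x / 2 * (s - x) ^ 2)
      (fun s => f' x + f'' x * (s - x)) x t) as [c [Hct E]]; try assumption.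
  { intros s. auto_derive; [easy|]. simpl. field. }
  pose proof (unit_interval_between x t c Hx Ht Hct) as Hci.
  destruct (MVT_unit_interval f' f'' (fun s => f' x + f'' x * (s - x))
      (fun s => f'' x) x c) as [b [Hbc E']]; try assumption.
  { intros s. auto_derive; [easy|]. ring. }
  pose proof (unit_interval_between x c b Hx Hci Hbc) as Hbi.
  pose proof (Rabs_between _ _ _ Hct) as Lc. pose proof (Rabs_between _ _ _ Hbc) as Lb.
  pose proof (Hmod x b Hx Hbi) as Hb.
  replace (f t - _) with ((f'' b - f'' x) * (c - x) * (t - x)).
  2:{ transitivity ((f' c - (f' x + f'' x * (c - x))) * (t - x)).
      - f_equal. rewrite <- E'. ring.
      - rewrite <- E. ring. }
  rewrite !Rabs_mult. rewrite <- (pow2_abs (b - x)) in Hb.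
  replace ((t - x) ^ 4) with (((t - x) ^ 2) ^ 2) by ring. rewrite <- (pow2_abs (t - x)).
  pose proof (Rabs_pos (b - x)). pose proof (Rabs_pos (c - x)).
  pose proof (Rabs_pos (f'' b - f'' x)).
  set (r := Rabs (t - x)) in *.
  assert (Rabs (b - x) ^ 2 <= r ^ 2) by (apply pow_incr; lra).
  assert (Rabs (f'' b - f'' x) <= eps + C * r ^ 2).
  { eapply Rle_trans; [exact Hb|]. apply Rplus_le_compat_l, Rmult_le_compat_l; assumption. }
  replace (eps * r ^ 2 + C * (r ^ 2) ^ 2) with ((eps + C * r ^ 2) * r * r) by ring.
  repeat apply Rmult_le_compat; try assumption; try lra.
  apply Rmult_le_pos; assumption.
Qed.

(** * Asymptotics of the operator, uniformly in the point *)

Lemma continue_in_quartic (c0 c1 c2 c3 c4 x : R) :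
  continue_in (quartic c0 c1 c2 c3 c4) unit_interval x.
Proof.
  assert (H : continuity_pt (quartic c0 c1 c2 c3 c4) x).
  { apply continuity_pt_filterlim, (ex_derive_continuous (quartic c0 c1 c2 c3 c4)).
    unfold quartic. auto_derive; easy. }
  intros eps Heps. destruct (H eps Heps) as [d [Hd Hx]].
  exists d; split; [exact Hd|]. intros t [[_ Hne] Ht].
  apply Hx. split; [|exact Ht]. split; [exact I | auto].
Qed.

(** An affine function is nonnegative on [0, 1] as soon as it is so at 0 and 1. *)
Lemma alpha_lin_ge0 (a0 a1 : nat -> R) (n : nat) (x : R) :
  0 <= a0 n -> 0 <= a0 n + a1 n -> unit_interval x -> 0 <= alpha_lin a0 a1 x n.
Proof. intros H0 H1 [Hx0 Hx1]. unfold alpha_lin. nra. Qed.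

Lemma genuine_BD_dist_le (a0 a1 : nat -> R) (n : nat) (x : R) (g h P : R -> R) :
  (2 <= n)%nat -> 0 <= a0 n -> 0 <= a0 n + a1 n -> unit_interval x ->
  (forall x, unit_interval x -> continue_in g unit_interval x) ->
  (forall x, unit_interval x -> continue_in h unit_interval x) ->
  (forall x, unit_interval x -> continue_in P unit_interval x) ->
  (forall t, unit_interval t -> Rabs (g t - h t) <= P t) ->
  Rabs (genuine_BD a0 a1 n g x - genuine_BD a0 a1 n h x) <= genuine_BD a0 a1 n P x.
Proof.
  intros Hn H0 H1 Hx Hg Hh HP H.
  assert (Hx' : unit_interval (1 - x)) by (destruct Hx; unfold unit_interval; lra).
  pose proof (alpha_lin_ge0 a0 a1 n x H0 H1 Hx) as W.
  pose proof (alpha_lin_ge0 a0 a1 n (1 - x) H0 H1 Hx') as W'.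
  rewrite !genuine_BD_node by exact Hn.
  set (w := alpha_lin a0 a1 x n) in *. set (w' := alpha_lin a0 a1 (1 - x) n) in *.
  match goal with |- Rabs (w * ?A + w' * ?B - (w * ?C + w' * ?D)) <= _ =>
    replace (w * A + w' * B - (w * C + w' * D)) with (w * (A - C) + w' * (B - D)) by ring
  end.
  eapply Rle_trans; [apply Rabs_triang|].
  rewrite !Rabs_mult, (Rabs_pos_eq w), (Rabs_pos_eq w') by assumption.
  apply Rplus_le_compat; apply Rmult_le_compat_l; try assumption;
    apply bernstein_mean_dist_le; try exact Hx;
    intros k Hk; apply node_dist_le; try assumption; lia.
Qed.

Lemma convex_dist_le (w w' u v l b : R) :
  0 <= w -> 0 <= w' -> w + w' = 1 -> Rabs (u - l) <= b -> Rabs (v - l) <= b ->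
  Rabs (w * u + w' * v - l) <= b.
Proof.
  intros Hw Hw' E Hu%Rabs_le_between Hv%Rabs_le_between. apply Rabs_le_between.
  replace (w * u + w' * v - l) with (w * (u - l) + w' * (v - l))
    by (replace l with ((w + w') * l) at 3 by (rewrite E; ring); ring).
  replace b with (w * b + w' * b) by (rewrite <- Rmult_plus_distr_r, E; ring).
  split; nra.
Qed.

(** The quartic is [b0 + b1 (t - x) + b2 (t - x)^2], expanded in powers of [t].
    For [z] equal to [x] and [1 - x], [n] times the second central moments of
    the two means making up the operator exceed [2x(1 - x)] by
    [(6 z^2 - 4 z) / (n + 1)]. *)
Lemma genuine_BD_parabola (a0 a1 : nat -> R) (n : nat) (b0 b1 b2 x : R) :
  (2 <= n)%nat -> 2 * a0 n + a1 n = 1 -> 0 <= a0 n -> 0 <= a0 n + a1 n ->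
  unit_interval x ->
  Rabs (INR n * (genuine_BD a0 a1 n
          (quartic (b0 - b1 * x + b2 * x ^ 2) (b1 - 2 * b2 * x) b2 0 0) x - b0)
        - (b1 * ((1 - a0 n) * (1 - 2 * x)) + b2 * (2 * (x * (1 - x)))))
  <= Rabs b2 * (4 / INR n).
Proof.
  intros Hn Hs H0 H1 Hx.
  pose proof (le_INR _ _ Hn) as Hy; simpl in Hy.
  assert (Hx' : unit_interval (1 - x)) by (destruct Hx; unfold unit_interval; lra).
  pose proof (alpha_lin_ge0 a0 a1 n x H0 H1 Hx) as W.
  pose proof (alpha_lin_ge0 a0 a1 n (1 - x) H0 H1 Hx') as W'.
  rewrite genuine_BD_quartic by exact Hn. cbv zeta.
  assert (Hw : alpha_lin a0 a1 x n + alpha_lin a0 a1 (1 - x) n = 1)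
    by (unfold alpha_lin; lra).
  set (w := alpha_lin a0 a1 x n) in *. set (w' := alpha_lin a0 a1 (1 - x) n) in *.
  set (y := INR n) in *.
  (* [n] times the first central moment is [- x w + (1 - x) w']. *)
  assert (Hmean : (1 - a0 n) * (1 - 2 * x) = w' - x).
  { unfold w', alpha_lin. replace (a1 n) with (1 - 2 * a0 n) by lra. ring. }
  rewrite Hmean.
  match goal with |- Rabs ?e <= _ =>
    replace e with (b2 * (w * ((6 * x ^ 2 - 4 * x) / (y + 1))
                          + w' * ((6 * (1 - x) ^ 2 - 4 * (1 - x)) / (y + 1)) - 0))
  end.
  - rewrite Rabs_mult. apply Rmult_le_compat_l; [apply Rabs_pos|].
    assert (Hq : forall z, unit_interval z -> Rabs ((6 * z ^ 2 - 4 * z) / (y + 1) - 0) <= 4 / y).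
    { intros z [Hz0 Hz1]. rewrite Rminus_0_r. unfold Rdiv.
      rewrite Rabs_mult, (Rabs_pos_eq (/ (y + 1)))
        by (apply Rlt_le, Rinv_0_lt_compat; lra).
      apply Rmult_le_compat; try apply Rabs_pos.
      - apply Rlt_le, Rinv_0_lt_compat; lra.
      - apply Rabs_le_between. split; nra.
      - apply Rinv_le_contravar; lra. }
    apply convex_dist_le; auto.
  - replace w with (1 - w') by lra. clearbody w' y. clear - Hy. field. lra.
Qed.

(** The quartic is [b2 (t - x)^2 + b4 (t - x)^4], the form of the bound on the
    Taylor remainder. The fourth central moment has order [n^-2] because, over
    the common denominator [n (n+1) (n+2) (n+3)], all powers of [n] above the
    second cancel in the numerators ([A] and [B] in the proof). *)
Lemma genuine_BD_remainder_le (a0 a1 : nat -> R) (n : nat) (b2 b4 x : R) :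
  (2 <= n)%nat -> 2 * a0 n + a1 n = 1 -> 0 <= a0 n -> 0 <= a0 n + a1 n ->
  unit_interval x -> 0 <= b2 -> 0 <= b4 ->
  INR n * genuine_BD a0 a1 n
    (quartic (b2 * x ^ 2 + b4 * x ^ 4) (- 2 * b2 * x - 4 * b4 * x ^ 3)
       (b2 + 6 * b4 * x ^ 2) (- 4 * b4 * x) b4) x
  <= b2 * (5 / 2) + b4 * (1152 / INR n).
Proof.
  intros Hn Hs H0 H1 Hx Hb2 Hb4.
  pose proof (le_INR _ _ Hn) as Hy; simpl in Hy.
  pose proof (genuine_BD_parabola a0 a1 n 0 0 b2 x Hn Hs H0 H1 Hx) as HP.
  rewrite genuine_BD_quartic in HP |- * by exact Hn. cbv zeta in HP |- *.
  assert (Hx' : unit_interval (1 - x)) by (destruct Hx; unfold unit_interval; lra).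
  pose proof (alpha_lin_ge0 a0 a1 n x H0 H1 Hx) as W.
  pose proof (alpha_lin_ge0 a0 a1 n (1 - x) H0 H1 Hx') as W'.
  assert (Hw : alpha_lin a0 a1 x n + alpha_lin a0 a1 (1 - x) n = 1)
    by (unfold alpha_lin; lra).
  set (w := alpha_lin a0 a1 x n) in *. set (w' := alpha_lin a0 a1 (1 - x) n) in *.
  set (y := INR n) in *.
  apply Rabs_le_between in HP. destruct HP as [_ HP]. rewrite (Rabs_pos_eq b2) in HP by assumption.
  set (D := (y + 1) * (y + 2) * (y + 3)).
  assert (HD : 0 < D) by (unfold D; repeat apply Rmult_lt_0_compat; lra).
  set (A := (12*x^2 - 24*x^3 + 12*x^4) * y^2
            + (24*x - 156*x^2 + 312*x^3 - 180*x^4) * y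
            + (- 24*x + 144*x^2 - 288*x^3 + 192*x^4)).
  set (B := (12*x^2 - 24*x^3 + 12*x^4) * y^2
            + (72*x - 300*x^2 + 408*x^3 - 180*x^4) * y
            + (24 - 168*x + 432*x^2 - 480*x^3 + 192*x^4)).
  match type of HP with ?P - _ <= _ =>
    match goal with |- ?Q <= _ =>
      replace Q with (P + b4 * (w * (A / D) + w' * (B / D))) end end.
  2:{ unfold A, B, D. clearbody w w' y. clear - Hy. field. lra. }
  destruct Hx as [Hx0 Hx1].
  assert (Hpow : forall r, 0 <= x ^ r <= 1).
  { intros r; split; [now apply pow_le|].
    rewrite <- (pow1 r). apply pow_incr; lra. }
  pose proof (Hpow 2%nat). pose proof (Hpow 3%nat). pose proof (Hpow 4%nat).
  (* 24, 480 and 648 are the largest sums of positive coefficients of [y^2],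
     [y] and 1 in [A] and [B]; their total is 1152. *)
  assert (Hpoly : forall p2 p1 p0, p2 <= 24 -> p1 <= 480 -> p0 <= 648 ->
    p2 * y ^ 2 + p1 * y + p0 <= 1152 * y ^ 2).
  { intros p2 p1 p0 L2 L1 L0.
    assert (1 <= y ^ 2) by nra. assert (y <= y ^ 2) by nra.
    assert (p2 * y ^ 2 <= 24 * y ^ 2) by nra. assert (p1 * y <= 480 * y) by nra. lra. }
  assert (HA : A <= 1152 * y ^ 2) by (apply Hpoly; lra).
  assert (HB : B <= 1152 * y ^ 2) by (apply Hpoly; lra).
  assert (HAD : forall Z, Z <= 1152 * y ^ 2 -> Z / D <= 1152 / y).
  { intros Z HZ. apply Rmult_le_reg_r with (D * y); [apply Rmult_lt_0_compat; lra|].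
    replace (Z / D * (D * y)) with (Z * y) by (field; lra).
    replace (1152 / y * (D * y)) with (1152 * D) by (field; lra).
    assert (y ^ 2 * y <= D) by (unfold D; nra).
    nra. }
  apply HAD in HA, HB.
  assert (w * (A / D) + w' * (B / D) <= 1152 / y).
  { replace (1152 / y) with (w * (1152 / y) + w' * (1152 / y))
      by (rewrite <- Rmult_plus_distr_r, Hw; ring).
    apply Rplus_le_compat; apply Rmult_le_compat_l; assumption. }
  assert (b4 * (w * (A / D) + w' * (B / D)) <= b4 * (1152 / y))
    by (apply Rmult_le_compat_l; assumption).
  assert (4 / y <= 2).
  { apply Rmult_le_reg_r with y; [lra|]. replace (4 / y * y) with 4 by (field; lra). lra. }
  assert (2 * (x * (1 - x)) <= 1 / 2) by (pose proof (pow2_ge_0 (x - 1 / 2)); lra).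
  assert (b2 * (4 / y) <= b2 * 2) by (apply Rmult_le_compat_l; assumption).
  assert (b2 * (2 * (x * (1 - x))) <= b2 * (1 / 2)) by (apply Rmult_le_compat_l; assumption).
  lra.
Qed.

Theorem theorem2p2
  (a0 a1 : nat -> R) (l0 : R)
  (Ha0 : is_lim_seq a0 l0)
  (Ha1 : ex_finite_lim_seq a1)
  (Hsum : forall n : nat, (1 <= n)%nat -> 2 * a0 n + a1 n = 1)
  (Hpos0 : forall n : nat, (1 <= n)%nat -> 0 <= a0 n)
  (Hpos1 : forall n : nat, (1 <= n)%nat -> 0 <= a0 n + a1 n)
  (f f' f'' : R -> R)
  (Hf' : forall x : R, unit_interval x -> D_in f f' unit_interval x)
  (Hf'' : forall x : R, unit_interval x -> D_in f' f'' unit_interval x)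
  (Hcont : forall x : R, unit_interval x -> continue_in f'' unit_interval x) :
  forall eps : R, 0 < eps ->
  exists N : nat, forall n : nat, (N <= n)%nat -> (1 <= n)%nat ->
  forall x : R, unit_interval x ->
  Rabs (INR n * (genuine_BD a0 a1 n f x - f x)
        - ((1 - 2 * x) * (1 - l0) * f' x + x * (1 - x) * f'' x)) < eps.
Proof.
  intros eps Heps.
  destruct (bounded_on_unit_interval f') as [M1 [HM1 HB1]].
  { intros x Hx. eapply cont_deriv, Hf'', Hx. }
  destruct (bounded_on_unit_interval f'' Hcont) as [M2 [HM2 HB2]].
  (* [genuine_BD_remainder_le] multiplies [eps / 8] by 5/2, which leaves room
     for [eps / 4] each from the coefficient [a0 n] and the [1 / n] terms. *)
  destruct (taylor_remainder_le f f' f'' Hf' Hf'' Hcont (eps / 8) ltac:(lra))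
    as [C [HC HT]].
  assert (He : 0 < eps / (4 * (M1 + 1))) by (apply Rdiv_lt_0_compat; lra).
  apply is_lim_seq_spec in Ha0. destruct (Ha0 (mkposreal _ He)) as [N1 HN1]. simpl in HN1.
  set (K := 2 * M2 + 1152 * C).
  assert (HK : 0 <= K) by (unfold K; lra).
  destruct (nfloor_ex (4 * K / eps)) as [N2 [_ HN2]].
  { apply Rmult_le_pos; [lra|]. apply Rlt_le, Rinv_0_lt_compat, Heps. }
  exists (N1 + N2 + 2)%nat. intros n Hn _ x Hx.
  assert (Hn2 : (2 <= n)%nat) by lia.
  specialize (Hsum n ltac:(lia)). specialize (Hpos0 n ltac:(lia)).
  specialize (Hpos1 n ltac:(lia)). specialize (HN1 n ltac:(lia)).
  assert (Hy : 4 * K / eps < INR n).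
  { eapply Rlt_le_trans; [exact HN2|]. rewrite <- S_INR. apply le_INR. lia. }
  assert (Hy2 : 2 <= INR n) by (apply (le_INR 2); lia).
  set (q := quartic (f x - f' x * x + f'' x / 2 * x ^ 2)
              (f' x - 2 * (f'' x / 2) * x) (f'' x / 2) 0 0).
  set (P := quartic (eps / 8 * x ^ 2 + C * x ^ 4) (- 2 * (eps / 8) * x - 4 * C * x ^ 3)
              (eps / 8 + 6 * C * x ^ 2) (- 4 * C * x) C).
  assert (Hdist : Rabs (genuine_BD a0 a1 n f x - genuine_BD a0 a1 n q x)
                  <= genuine_BD a0 a1 n P x).
  { apply genuine_BD_dist_le; try assumption.
    - intros s Hs. eapply cont_deriv, Hf', Hs.
    - intros s _. apply continue_in_quartic.
    - intros s _. apply continue_in_quartic.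
    - intros t Ht. eapply Rle_trans; [|eapply Rle_trans; [apply (HT x t Hx Ht)|]].
      + right. f_equal. unfold q, quartic. ring.
      + right. unfold P, quartic. ring. }
  pose proof (genuine_BD_parabola a0 a1 n (f x) (f' x) (f'' x / 2) x
                Hn2 Hsum Hpos0 Hpos1 Hx) as Hq. fold q in Hq.
  pose proof (genuine_BD_remainder_le a0 a1 n (eps / 8) C x
                Hn2 Hsum Hpos0 Hpos1 Hx ltac:(lra) HC) as HP. fold P in HP.
  set (y := INR n) in *.
  set (Uf := genuine_BD a0 a1 n f x) in *. set (Uq := genuine_BD a0 a1 n q x) in *.
  set (UP := genuine_BD a0 a1 n P x) in *.
  assert (Hlim : Rabs (f' x * (1 - 2 * x) * (l0 - a0 n)) <= eps / 4).
  { rewrite !Rabs_mult, (Rabs_minus_sym l0).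
    assert (Rabs (1 - 2 * x) <= 1) by (destruct Hx; apply Rabs_le_between; lra).
    replace (eps / 4) with ((M1 + 1) * 1 * (eps / (4 * (M1 + 1)))) by (field; lra).
    pose proof (HB1 x Hx).
    repeat apply Rmult_le_compat; try apply Rabs_pos; try lra.
    apply Rmult_le_pos; apply Rabs_pos. }
  assert (HKy : K / y < eps / 4).
  { apply Rmult_lt_reg_r with (4 * y / eps).
    - apply Rdiv_lt_0_compat; lra.
    - replace (K / y * (4 * y / eps)) with (4 * K / eps) by (field; lra).
      replace (eps / 4 * (4 * y / eps)) with y by (field; lra). exact Hy. }
  assert (Hq' : Rabs (f'' x / 2) * (4 / y) <= 2 * M2 / y).
  { unfold Rdiv. rewrite Rabs_mult, (Rabs_pos_eq (/ 2)) by lra.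
    replace (2 * M2 * / y) with (M2 * / 2 * (4 * / y)) by (field; lra).
    apply Rmult_le_compat_r.
    - apply Rmult_le_pos; [lra|]. apply Rlt_le, Rinv_0_lt_compat; lra.
    - apply Rmult_le_compat_r; [lra | apply HB2, Hx]. }
  assert (Hd : Rabs (y * (Uf - Uq)) <= y * UP).
  { rewrite Rabs_mult, (Rabs_pos_eq y) by lra. apply Rmult_le_compat_l; lra. }
  replace (K / y) with (2 * M2 / y + C * (1152 / y)) in HKy by (unfold K; field; lra).
  match goal with |- Rabs ?e < _ =>
    replace e with (y * (Uf - Uq)
      + (y * (Uq - f x) - (f' x * ((1 - a0 n) * (1 - 2 * x)) + f'' x / 2 * (2 * (x * (1 - x)))))
      + f' x * (1 - 2 * x) * (l0 - a0 n)) by field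
  end.
  eapply Rle_lt_trans; [apply Rabs_triang|].
  eapply Rle_lt_trans; [apply Rplus_le_compat_r, Rabs_triang|].
  lra.
Qed.
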